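(* Let $\mathcal{M}$ be a constraint hypersurface of dimension $m$ with degenerate induced form, null distribution $\mathcal{N}$ of constant rank $k$, and constraint-preserving vector field $\mathcal{V}$ as described in the context. Suppose that: (1) the intrinsic evolution $\dot X=\mathcal{V}(X)$ defines a continuous semiflow on $\mathcal{M}$ which is asymptotically compact, and which admits a bounded absorbing set; (2) $\mathcal{N}$ is involutive with compact embedded leaves and Hausdorff leaf space $\mathcal{M}_{\mathrm{red}}$; (3) $\mathcal{V}$ is projectable with respect to the null foliation. Let $\mathcal{A}$ be the global attractor of the semiflow and $\mathcal{A}_\ast=\pi(\mathcal{A})$. Then $\mathcal{A}_\ast$ is a compact set in $\mathcal{M}_{\mathrm{red}}$, invariant under the reduced semiflow, satisfying $\dim_T(\mathcal{A}_\ast)\le m-k$, where $\dim_T$ denotes the covering dimension.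
   Context: Geometric setting. $\mathcal{U}$ is a smooth $n$-dimensional manifold with a smooth symmetric $(0,2)$-tensor field $g$ of Lorentzian signature $(-,+,\dots,+)$; $\Phi:\mathcal{U}\to\mathbb{R}$ is smooth with $d\Phi\neq 0$ on $\Phi^{-1}(0)$; $\mathcal{M}=\Phi^{-1}(0)$, $m=\dim\mathcal{M}$. The restriction $g^{\mathcal{M}}=g|_{T\mathcal{M}\times T\mathcal{M}}$ has constant corank $k\ge 1$ and $\mathcal{N}=\ker g^{\mathcal{M}}\subset T\mathcal{M}$ is the null distribution. $\mathcal{V}$ is a $C^2$ vector field on $\mathcal{U}$ with $d\Phi(\mathcal{V})=0$ on $\mathcal{M}$, regarded as a vector field on $\mathcal{M}$. Foliation and quotient. When $\mathcal{N}$ is involutive, $\mathscr{F}$ is the foliation of $\mathcal{M}$ by the (connected, maximal) integral manifolds of $\mathcal{N}$ (leaves), and $\mathcal{M}_{\mathrm{red}}=\mathcal{M}/\mathscr{F}$. With compact embedded leaves and Hausdorff leaf space, $\mathcal{M}_{\mathrm{red}}$ carries the smooth structure of dimension $m-k$ for which the projection $\pi:\mathcal{M}\to\mathcal{M}_{\mathrm{red}}$ is a surjective submersion with fibers the leaves. $\mathcal{V}$ is projectable if $[\mathcal{V},W]\in\Gamma(\mathcal{N})$ for all $W\in\Gamma(\mathcal{N})$, so that there is a unique vector field $\mathcal{V}_*$ on $\mathcal{M}_{\mathrm{red}}$ with $D\pi_X(\mathcal{V}(X))=\mathcal{V}_*(\pi(X))$; the reduced semiflow is the one on $\mathcal{M}_{\mathrm{red}}$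 generated by $\mathcal{V}_*$, i.e. $\pi(\varphi_t(X))$ is the image of $\pi(X)$ at time $t$. Dynamics. ''Bounded'' and $\operatorname{dist}$ refer to a fixed distance on $\mathcal{M}$ inducing its topology. The semiflow $(\varphi_t)_{t\ge0}$ is asymptotically compact if for every bounded sequence $\{X_k\}$ and every $t_k\to\infty$, $\varphi_{t_k}(X_k)$ has a convergent subsequence in $\mathcal{M}$. A bounded absorbing set is a bounded $\mathcal{B}\subset\mathcal{M}$ such that each bounded $D\subset\mathcal{M}$ has $T_D\ge0$ with $\varphi_t(D)\subset\mathcal{B}$ for $t\ge T_D$. A set is invariant if its image under the time-$t$ map equals the set for all $t\ge 0$. The global attractor $\mathcal{A}$ is the unique compact invariant subset of $\mathcal{M}$ attracting all bounded sets: $\sup_{X\in D}\operatorname{dist}(\varphi_t(X),\mathcal{A})\to0$ for every bounded $D$. *)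

(* Defs.v *)
From HB Require Import structures.
From mathcomp Require Import all_boot all_order all_algebra.
From mathcomp Require Import generic_quotient.
From mathcomp Require Import all_classical all_reals all_analysis.
Import Order.TTheory GRing.Theory Num.Theory.
Import numFieldNormedType.Exports.

Set Implicit Arguments.
Unset Strict Implicit.
Unset Printing Implicit Defensive.

Local Open Scope classical_set_scope.
Local Open Scope ring_scope.

(* Vectors are rows and act on the left of matrices: the differential of
   f : R^n -> R^p at x is v |-> v *m 'J f x, with 'J f x : 'M_(n, p). *)

(* Meant for open D. *)
Fixpoint Cr_on (R : realType) (W : normedModType R) (n r : nat)
    (D : set 'rV[R]_n) (f : 'rV[R]_n -> W) : Prop :=
  if r is r'.+1 then
    (forall x, D x -> differentiable f x) /\
    (forall i : 'I_n, Cr_on r' D ('D_(delta_mx 0 i) f))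
  else forall x, D x -> {for x, continuous f}.

Definition smooth_on (R : realType) (W : normedModType R) (n : nat)
    (D : set 'rV[R]_n) (f : 'rV[R]_n -> W) : Prop :=
  forall r, Cr_on r D f.

(* [chart_map] is only meaningful on [chart_dom], and [chart_inv] on
   [chart_map @` chart_dom]. *)
Record chart (R : realType) (T : topologicalType) (n : nat) := Chart {
  chart_dom : set T;
  chart_map : T -> 'rV[R]_n;
  chart_inv : 'rV[R]_n -> T;
  chart_dom_open : open chart_dom;
  chart_im_open : open (chart_map @` chart_dom);
  chart_mapK : forall p, chart_dom p -> chart_inv (chart_map p) = p;
  chart_map_continuous :
    forall p, chart_dom p -> {for p, continuous chart_map};
  chart_inv_continuous :
    forall x, (chart_map @` chart_dom) x -> {for x, continuous chart_inv} }.

Definition chart_im (R : realType) (T : topologicalType) (n : nat)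
  (c : chart R T n) : set 'rV[R]_n := chart_map c @` chart_dom c.

(* The preferred chart [chart_at p] identifies the tangent space at p with
   'rV_n: a tangent vector at p is given by its components in [chart_at p]. *)
Record manifold (R : realType) (T : topologicalType) (n : nat) := Manifold {
  atlas : set (chart R T n);
  chart_at : T -> chart R T n;
  chart_at_atlas : forall p, atlas (chart_at p);
  dom_chart_at : forall p, chart_dom (chart_at p) p;
  atlas_compat : forall c c', atlas c -> atlas c' ->
    smooth_on (chart_map c @` (chart_dom c `&` chart_dom c'))
              (chart_map c' \o chart_inv c);
  manifold_hausdorff : hausdorff_space T;
  manifold_second_countable : @second_countable T }.

Section Calculus.
Context (R : realType) (T : topologicalType) (n : nat) (sT : manifold R T n).

Definition smooth_fun (f : T -> R) : Prop :=
  forall c, atlas sT c -> smooth_on (chart_im c) (f \o chart_inv c).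

Definition dfun (f : T -> R) (p : T) : 'cV[R]_n :=
  \col_i 'D_(delta_mx 0 i) (f \o chart_inv (chart_at sT p))
           (chart_map (chart_at sT p) p).

(* Components in the chart c, at the point of coordinates x, of the vector
   field X, whose value X p is expressed in [chart_at p]. *)
Definition vf_coord (c : chart R T n) (X : T -> 'rV[R]_n) (x : 'rV[R]_n) :=
  let p := chart_inv c x in
  X p *m 'J (chart_map c \o chart_inv (chart_at sT p))
            (chart_map (chart_at sT p) p).

Definition Cr_vfield (r : nat) (X : T -> 'rV[R]_n) : Prop :=
  forall c, atlas sT c -> Cr_on r (chart_im c) (vf_coord c X).

Definition smooth_vfield (X : T -> 'rV[R]_n) : Prop :=
  forall r, Cr_vfield r X.

(* [X, Y]^i = X^j d_j Y^i - Y^j d_j X^i, for C^1 fields *)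
Definition lie_bracket (X Y : T -> 'rV[R]_n) (p : T) : 'rV[R]_n :=
  let c := chart_at sT p in
  X p *m 'J (vf_coord c Y) (chart_map c p)
  - Y p *m 'J (vf_coord c X) (chart_map c p).

(* A (0,2)-tensor field g is given by its Gram matrices in the preferred
   charts: g_p(v, w) = v *m g p *m w^T. *)
Definition form_coord (c : chart R T n) (g : T -> 'M[R]_n) (x : 'rV[R]_n) :=
  let p := chart_inv c x in
  let J := 'J (chart_map (chart_at sT p) \o chart_inv c) x in
  J *m g p *m J^T.

Definition smooth_form (g : T -> 'M[R]_n) : Prop :=
  forall c, atlas sT c -> smooth_on (chart_im c) (form_coord c g).

(* A distribution assigns to p the row space of D p. *)
Definition section_of (D : T -> 'M[R]_n) (X : T -> 'rV[R]_n) : Prop :=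
  forall p, (X p <= D p)%MS.

Definition involutive_distribution (D : T -> 'M[R]_n) : Prop :=
  forall X Y, smooth_vfield X -> smooth_vfield Y ->
    section_of D X -> section_of D Y -> section_of D (lie_bracket X Y).

Definition projectable (D : T -> 'M[R]_n) (V : T -> 'rV[R]_n) : Prop :=
  forall W, smooth_vfield W -> section_of D W -> section_of D (lie_bracket V W).

(* Solution on [0, +oo[ of c' = X(c); the derivative at 0 is one-sided. *)
Definition integral_curve (X : T -> 'rV[R]_n) (c : R -> T) : Prop :=
  forall t, 0 <= t ->
    h^-1 *: (chart_map (chart_at sT (c t)) (c (t + h))
             - chart_map (chart_at sT (c t)) (c t))
      @[h --> within [set h | 0 <= t + h] 0^'] --> X (c t).

End Calculus.

Definition lorentzian (R : realType) (n : nat) (g : 'M[R]_n.+1) : Prop :=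
  g^T = g /\ exists2 P, P \in unitmx &
    P *m g *m P^T = diag_mx (\row_i (if i == ord0 then -1 else 1)).

Section Maps.
Context (R : realType) (S T : topologicalType) (n p : nat).
Context (sS : manifold R S n) (sT : manifold R T p).

Definition smooth_map (f : S -> T) : Prop :=
  continuous f /\ forall c c', atlas sS c -> atlas sT c' ->
    smooth_on (chart_map c @` (chart_dom c `&` f @^-1` chart_dom c'))
              (chart_map c' \o f \o chart_inv c).

Definition mdiff (f : S -> T) (x : S) : 'M[R]_(n, p) :=
  'J (chart_map (chart_at sT (f x)) \o f \o chart_inv (chart_at sS x))
     (chart_map (chart_at sS x) x).

Definition immersion (f : S -> T) : Prop :=
  smooth_map f /\ forall x, row_free (mdiff f x).

Definition submersion (f : S -> T) : Prop :=
  smooth_map f /\ forall x, row_full (mdiff f x).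

End Maps.

Definition topological_embedding (S T : topologicalType) (f : S -> T) : Prop :=
  [/\ continuous f, injective f & forall x A, nbhs x A ->
    exists2 B, nbhs (f x) B & f @^-1` B `<=` A].

Section Hypersurface.
Context (R : realType) (U : topologicalType) (m : nat).
Context (sU : manifold R U m.+1) (Phi : U -> R).

(* carries the subset topology *)
Definition hypersurface : topologicalType := set_type [set p | Phi p = 0].

Definition hyp_incl : hypersurface -> U := set_val.

Context (sM : manifold R hypersurface m).

Definition induced_form (g : U -> 'M[R]_m.+1) (p : hypersurface) : 'M[R]_m :=
  mdiff sM sU hyp_incl p *m g (hyp_incl p) *m (mdiff sM sU hyp_incl p)^T.

Definition null_distribution (g : U -> 'M[R]_m.+1) (p : hypersurface) :
    'M[R]_m :=
  kermx (induced_form g p).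

(* When V (hyp_incl p) lies in the image of the injective differential of
   [hyp_incl] at p, this is its unique preimage. *)
Definition intrinsic_vfield (V : U -> 'rV[R]_m.+1) (p : hypersurface) :
    'rV[R]_m :=
  V (hyp_incl p) *m pinvmx (mdiff sM sU hyp_incl p).

End Hypersurface.

Section Foliation.
Context (R : realType) (M : topologicalType) (m : nat) (sM : manifold R M m).
Context (N : M -> 'M[R]_m) (k : nat).

Definition integral_manifold (L : topologicalType) (sL : manifold R L k)
    (j : L -> M) : Prop :=
  [/\ connected [set: L], injective j, immersion sL sM j &
      forall q, (mdiff sL sM j q == N (j q))%MS].

Definition leaf (S : set M) : Prop :=
  (exists (L : topologicalType) (sL : manifold R L k) (j : L -> M),
     integral_manifold sL j /\ range j = S) /\
  (forall (L : topologicalType) (sL : manifold R L k) (j : L -> M),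
     integral_manifold sL j -> S `<=` range j -> range j = S).

Definition compact_embedded_leaf (S : set M) : Prop :=
  compact S /\
  exists (L : topologicalType) (sL : manifold R L k) (j : L -> M),
    [/\ integral_manifold sL j, topological_embedding j & range j = S].

(* For an involutive distribution the leaves partition M, and two points are
   related iff they lie on a common leaf; this form of the relation is an
   equivalence without any assumption. *)
Definition same_leaf (x y : M) : bool :=
  `[< forall S, leaf S -> (S x <-> S y) >].

Lemma same_leaf_refl : reflexive same_leaf.
Proof. by move=> x; apply/asboolP. Qed.

Lemma same_leaf_sym : symmetric same_leaf.
Proof.
by move=> x y; apply/asboolP/asboolP => h S lS; apply: iff_sym; exact: h.
Qed.

Lemma same_leaf_trans : transitive same_leaf.
Proof.
move=> y x z /asboolP xy /asboolP yz; apply/asboolP => S lS.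
exact: iff_trans (xy S lS) (yz S lS).
Qed.

Definition leaf_equiv : equiv_rel M :=
  EquivRel same_leaf same_leaf_refl same_leaf_sym same_leaf_trans.

Definition leaf_space : topologicalType :=
  quotient_topology {eq_quot leaf_equiv}%qT.

Definition leaf_proj (x : M) : leaf_space := (\pi_({eq_quot leaf_equiv}) x)%qT.

End Foliation.

Section Reduction.
Context (R : realType) (U : topologicalType) (m k : nat).
Context (sU : manifold R U m.+1) (Phi : U -> R).
Context (sM : manifold R (hypersurface Phi) m) (g : U -> 'M[R]_m.+1).

Definition reduced_space : topologicalType :=
  leaf_space sM (null_distribution sU sM g) k.

Definition reduction : hypersurface Phi -> reduced_space :=
  leaf_proj sM (null_distribution sU sM g) k.

End Reduction.

Section Dynamics.
Context (R : realType) (M : topologicalType).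

Definition continuous_semiflow (phi : R -> M -> M) : Prop :=
  [/\ {within [set z : R * M | 0 <= z.1], continuous (fun z => phi z.1 z.2)},
      forall x, phi 0 x = x &
      forall s t x, 0 <= s -> 0 <= t -> phi (s + t) x = phi s (phi t x)].

Definition generates (m : nat) (sM : manifold R M m) (V : M -> 'rV[R]_m)
    (phi : R -> M -> M) : Prop :=
  continuous_semiflow phi /\ forall x, integral_curve sM V (phi^~ x).

Definition invariant_under (phi : R -> M -> M) (A : set M) : Prop :=
  forall t, 0 <= t -> phi t @` A = A.

Context (d : M -> M -> R).

Definition distance_inducing_topology : Prop :=
  [/\ forall x y, d x y = 0 <-> x = y,
      forall x y, d x y = d y x,
      forall x y z, d x z <= d x y + d y z &
      forall x (B : set M), nbhs x B <->
        exists2 e, 0 < e & [set y | d x y < e] `<=` B].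

Definition dbounded (D : set M) : Prop :=
  exists r, forall x y, D x -> D y -> d x y <= r.

(* +oo when A is empty *)
Definition dist_set (x : M) (A : set M) : \bar R :=
  ereal_inf [set (d x a)%:E | a in A].

Definition asymptotically_compact (phi : R -> M -> M) : Prop :=
  forall (X : nat -> M) (t : nat -> R),
    dbounded (range X) -> t i @[i --> \oo] --> +oo ->
    exists (s : nat -> nat) (l : M),
      {homo s : i j / (i < j)%N} /\ phi (t (s i)) (X (s i)) @[i --> \oo] --> l.

Definition bounded_absorbing (phi : R -> M -> M) (B : set M) : Prop :=
  dbounded B /\ forall D, dbounded D ->
    exists2 T, 0 <= T & forall t, T <= t -> phi t @` D `<=` B.

Definition global_attractor (phi : R -> M -> M) (A : set M) : Prop :=
  [/\ compact A, invariant_under phi A &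
      forall D, dbounded D -> D !=set0 ->
        ereal_sup [set dist_set (phi t x) A | x in D] @[t --> +oo] --> 0%E].

End Dynamics.

(* Lebesgue covering dimension at most n: every open cover has an open
   refinement such that each point lies in at most n + 1 of its members. *)
Definition covering_dim_le (X : topologicalType) (n : nat) : Prop :=
  forall C : set (set X), C `<=` open -> \bigcup_(O in C) O = setT ->
  exists C' : set (set X),
    [/\ C' `<=` open, \bigcup_(O in C') O = setT,
        (forall O', C' O' -> exists2 O, C O & O' `<=` O) &
        forall x, ([set O | C' O /\ O x] #<= `I_n.+1)%card].

(* Main.v *)
(* The projection pi maps integral curves of V to integral curves of V_*, which
   are unique because V_* is C^1 and hence locally Lipschitz in charts; so pi
   intertwines the two semiflows, and the image of an invariant set is
   invariant. The image is compact, so the dimension bound is the fact that a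
   compact subset K of an n-manifold has covering dimension at most n. As K is
   covered by finitely many compact pieces lying in charts, it is enough to
   shrink covers on one such piece. There one uses n + 1 families of pairwise
   disjoint open cubes of R^n of size below a Lebesgue number, which together
   cover R^n. *)
Require Import Defs.
From HB Require Import structures.
From mathcomp Require Import all_boot all_order all_algebra.
From mathcomp Require Import all_classical all_reals all_analysis.
From mathcomp Require Import lra ring.
Import Order.TTheory GRing.Theory Num.Theory.
Import numFieldNormedType.Exports.
Set Implicit Arguments.
Unset Strict Implicit.
Local Open Scope classical_set_scope.
Local Open Scope ring_scope.

(** * Covering dimension relative to a subset *)

(* The covering dimension of K relative to T: every open cover of T shrinks,
   with the same index set, to an open cover of order at most n + 1 at the
   points of K. Keeping the index set makes the finite sum theorem immediate,
   since shrinking further on L cannot raise the order on K. *)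
Definition dim_le_in (T : topologicalType) (K : set T) (n : nat) : Prop :=
  forall (I : Type) (U : I -> set T),
    (forall i, open (U i)) -> (forall x, exists i, U i x) ->
  exists V : I -> set T,
    [/\ forall i, open (V i), forall x, exists i, V i x,
        forall i, V i `<=` U i &
        forall x, K x -> ([set i | V i x] #<= `I_n.+1)%card].

Lemma dim_le_inS (T : topologicalType) (K L : set T) n :
  K `<=` L -> dim_le_in L n -> dim_le_in K n.
Proof.
move=> KL dL I U oU cU; have [V [oV cV VU ordV]] := dL I U oU cU.
by exists V; split=> // x /KL; exact: ordV.
Qed.

Lemma dim_le_in0 (T : topologicalType) n : dim_le_in (set0 : set T) n.
Proof. by move=> I U oU cU; exists U; split=> [||i x|x []]. Qed.

Lemma dim_le_inU (T : topologicalType) (K L : set T) n :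
  dim_le_in K n -> dim_le_in L n -> dim_le_in (K `|` L) n.
Proof.
move=> dK dL I U oU cU; have [V [oV cV VU ordV]] := dK I U oU cU.
have [W [oW cW WV ordW]] := dL I V oV cV.
exists W; split=> // [i|x [Kx|Lx]]; last exact: ordW.
  exact: subset_trans (WV i) (VU i).
apply: card_le_trans (ordV x Kx); apply: subset_card_le => i; exact: WV.
Qed.

Lemma dim_le_in_compact (T : topologicalType) (K : set T) n :
  compact K ->
  (forall x, K x -> exists2 L, nbhs x L & dim_le_in L n) ->
  dim_le_in K n.
Proof.
move=> cK locK; apply: contrapT => ndK.
(* Were the claim false, the sets with small complement in K would form a proper
   filter, with a cluster point in K. *)
pose F : set_system T := [set A | dim_le_in (K `\` A) n].
have FF : ProperFilter F.
  apply: Build_ProperFilter_ex => [A FA|].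
    apply: contrapT => A0; apply: ndK; apply: dim_le_inS FA => x Kx.
    by split=> // Ax; apply: A0; exists x.
  split=> [|A B FA FB|A B AB FA].
  - by rewrite /F /= setDT; exact: dim_le_in0.
  - by rewrite /F /= setDIr; exact: dim_le_inU.
  - by apply: dim_le_inS FA; exact: setDS.
have FK : F K by rewrite /F /= setDv; exact: dim_le_in0.
have [x [Kx clx]] := cK F FF FK.
have [L nL dL] := locK x Kx.
(* [K] minus the complement of [L] lies in [L], so this complement belongs to [F]; the neighbourhood
   [L] of the cluster point [x] would have to meet it. *)
have FL : F (~` L) by apply: dim_le_inS dL => y [_] /contrapT.
by have [y []] := clx _ _ FL nL.
Qed.

(** A cover of the subspace becomes a cover of [T] by extending its members to open sets of [T] and
    adding the complement of [K], open because [K] is closed. The shrinking is then traced on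
    [K]. *)
Lemma covering_dim_le_closed (T : topologicalType) (K : set T) n :
  closed K -> dim_le_in K n -> covering_dim_le (set_type K) n.
Proof.
move=> clK dK C oC cC.
have /choice[G GP] (W : set (set_type K)) :
    exists G, open G /\ (C W -> set_val @^-1` G = W).
  have [CO|nCO] := pselect (C W); last by exists set0; split=> //; exact: open0.
  by have [G oG GO] := oC _ CO; exists G.
pose U (o : option (set (set_type K))) :=
  if o is Some W then [set x | C W /\ G W x] else ~` K.
have oU o : open (U o).
  case: o => [W|] /=; last exact: closed_openC.
  have [CO|nCO] := pselect (C W).
    by rewrite (_ : mkset _ = G W) ?eqEsubset; [case: (GP W)|split=> x // []].
  by rewrite (_ : mkset _ = set0) ?eqEsubset; [exact: open0|split=> x // []].
have cU x : exists o, U o x.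
  have [Kx|nKx] := pselect (K x); last by exists None.
  have : [set: set_type K] (SigSub (mem_set Kx)) by [].
  rewrite -cC => -[W CO Ox]; exists (Some W); split=> //.
  by have [_ /(_ CO) GO] := GP W; move: Ox; rewrite -{1}GO.
have [V [oV cV VU ordV]] := dK _ U oU cU.
pose V' W : set (set_type K) := set_val @^-1` V (Some W).
exists (V' @` C); split.
- move=> _ [W CO <-].
  by have /continuousP := @initial_continuous (set_type K) T set_val; exact.
- apply/seteqP; split=> // x _; have [[W|] VO] := cV (set_val x).
    by have [CO _] := VU _ _ VO; exists (V' W) => //; exists W.
  by have := VU _ _ VO; case; exact: set_valP.
- move=> _ [W CO <-]; exists W => // x /VU [_ GO].
  by have [_ /(_ CO) <-] := GP W.
- move=> x; have Kx : K (set_val x) by exact: set_valP.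
  apply: card_le_trans (ordV _ Kx).
  (* Distinct indices may have equal traces, so the members at [x] are counted as images of indices;
     the value at [None] is a mere default. *)
  pose f (o : option (set (set_type K))) := if o is Some W then V' W else set0.
  apply: card_le_trans (card_image_le f _); apply: subset_card_le => _ [[W CO <-] V'x].
  by exists (Some W).
Qed.

(** * Coloured cubes and the dimension of compact sets in manifolds *)

Section Cubes.
Context {R : realType} {n : nat}.

(* The cells of colour j: the components of the complement of the hyperplanes
   x_i = s (j + (n + 1) z), z integer. *)
Definition cube (s : R) (j : 'I_n.+1) (a : 'I_n -> int) : set 'rV[R]_n :=
  [set x | forall i, s * (j%:R + n.+1%:R * (a i)%:~R) < x ord0 i
                     < s * (j%:R + n.+1%:R * (a i + 1)%:~R)].

Lemma cube_inj (s : R) j a b x : 0 < s -> cube s j a x -> cube s j b x -> a = b.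
Proof.
move=> s0 ax bx; apply/funext => i.
have /andP[ax1 ax2] := ax i; have /andP[bx1 bx2] := bx i.
have lt_int (c d : int) :
    s * (j%:R + n.+1%:R * c%:~R) < s * (j%:R + n.+1%:R * (d + 1)%:~R) -> c <= d.
  by rewrite ltr_pM2l// ltrD2l ltr_pM2l// ltr_int ltzD1.
by apply/eqP; rewrite eq_le !lt_int// ?(lt_trans ax1)// (lt_trans bx1).
Qed.

(* Pigeonhole: each of the n coordinates lies on a removed hyperplane for at most
   one of the n + 1 colours. *)
Lemma cube_cover (s : R) x : 0 < s -> exists j a, cube s j a x.
Proof.
move=> s0; pose bad (j : 'I_n.+1) (i : 'I_n) :=
  `[< exists z : int, x ord0 i = s * (j%:R + n.+1%:R * z%:~R) >].
have bad_inj i j j' : bad j i -> bad j' i -> j = j'.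
  move=> /asboolP[z e] /asboolP[z']; rewrite e => /(mulfI (lt0r_neq0 s0)) {}e.
  have {}e : (j : int) + n.+1%:Z * z = (j' : int) + n.+1%:Z * z'.
    by apply: (@intr_inj R); rewrite !rmorphD !rmorphM.
  (* Both colours are below [n + 1], so reduction modulo [n + 1] recovers them. *)
  have := congr1 (fun t => (t %% n.+1%:Z)%Z) e.
  rewrite !(mulrC n.+1%:Z) !(addrC _ (_ * n.+1%:Z)) !modzMDl !modz_small//=.
  - by move=> [] /val_inj.
  - by rewrite ltz_nat ltn_ord.
  - by rewrite ltz_nat ltn_ord.
have [/forallP /= allbad|] := boolP [forall j, [exists i, bad j i]].
  pose f j := xchoose (existsP (allbad j)).
  have : injective f.
    move=> j j' ff; apply: (bad_inj (f j)); first exact: xchooseP.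
    by rewrite ff; exact: xchooseP.
  by move=> /leq_card; rewrite !card_ord ltnn.
rewrite negb_forall => /existsP[j /existsPn good].
(* The cell is the floor of the solution [t] of [x_i = s (j + (n + 1) t)]; the lower inequality is
   strict because [t] is not an integer for the good colour [j]. *)
exists j, (fun i => Num.floor ((x ord0 i / s - j%:R) / n.+1%:R)) => i.
have e : x ord0 i = s * (j%:R + n.+1%:R * ((x ord0 i / s - j%:R) / n.+1%:R)).
  by rewrite (mulrC n.+1%:R) divfK ?pnatr_eq0// addrC subrK mulrC divfK ?gt_eqF.
rewrite {2 3}e; set t := (_ / n.+1%:R) in e *.
rewrite !ltr_pM2l// !ltrD2l !ltr_pM2l// floorD1_gt andbT lt_neqAle floor_le_tmp andbT.
by apply: contraNN (good i) => /eqP te; apply/asboolP; exists (Num.floor t); rewrite te.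
Qed.

(** The norm on rows is the maximum norm, so the side length of a cell is the bound. *)
Lemma cube_dist (s : R) j a x y : 0 < s -> cube s j a x -> cube s j a y ->
  `|x - y| < s * n.+1%:R.
Proof.
move=> s0 ax ay; rewrite [ltLHS]/Num.norm/= mx_normrE; apply/bigmax_ltP; split=> /=.
  by rewrite mulr_gt0.
move=> [i0 i] _ /=; rewrite ord1 !mxE ltr_norml.
have := ax i; have := ay i; rewrite intrD !mulrDr mulr1 !addrA.
set u := _ + _; move=> /andP[? ?] /andP[? ?]; lra.
Qed.

Lemma open_cube (s : R) j a : open (cube s j a).
Proof.
rewrite openE => x ax; rewrite /interior.
pose I i : set R := `](s * (j%:R + n.+1%:R * (a i)%:~R)),
  (s * (j%:R + n.+1%:R * (a i + 1)%:~R))[%classic.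
have : nbhs x [set y | forall i, I i (y ord0 i)].
  have xF : Filter (nbhs x) by exact: nbhs_filter.
  apply: (@filter_forall 'rV[R]_n 'I_n (fun i y => I i (y ord0 i)) (nbhs x) xF) => i.
  have /(_ (I i)) := @coord_continuous R 1 n ord0 i x; apply.
  by apply: open_nbhs_nbhs; split; [exact: interval_open|rewrite /I /= in_itv; exact: ax].
by apply: filterS => y yi i; have := yi i; rewrite /I /= in_itv.
Qed.

End Cubes.

(** The last hypothesis is continuity of the inverse of [h] on the image of [K], phrased without
    naming an inverse. *)
Lemma dim_le_in_coord (R : realType) (T : topologicalType) n (K : set T)
    (h : T -> 'rV[R]_n) :
  compact K -> closed K -> (forall x, K x -> {for x, continuous h}) ->
  (forall x W, K x -> nbhs x W ->
    \forall e \near 0^'+, forall y, K y -> `|h x - h y| < e -> W y) ->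
  dim_le_in K n.
Proof.
move=> cK clK ch ih I U oU cU.
(* d is a Lebesgue number of the cover *)
have [d d0 dP] : exists2 d : R, 0 < d & forall x, K x ->
    exists i, forall y, K y -> `|h x - h y| < d -> U i y.
  have : \forall d \near (0:R)^'+, K `<=` (fun x =>
      exists i, forall y, K y -> `|h x - h y| < d -> U i y).
    apply: (iffRL (near_covering_withinP K)) => //; first exact/compact_near_coveringP.
    move=> x Kx; have [i Uix] := cU x.
    have /(ih x _ Kx) ihU : nbhs x (U i) by exact: open_nbhs_nbhs.
    have [e [e0 eU]] : exists e : R, 0 < e /\
        forall y, K y -> `|h x - h y| < e -> U i y.
      near (0:R)^'+ => e; exists e; split=> //.
      exact: (near ihU).
    (* Half of [e] is spent between [x] and [x'], the other half between [x'] and [y]. *)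
    have e2 : 0 < e / 2 by exact: divr_gt0.
    exists ([set x' | `|h x - h x'| < e / 2], [set d | d < e / 2]).
      by split; [move/cvgrPdist_lt : (ch x Kx); exact|exact: nbhs_right_lt].
    move=> [x' d] [/= hx hd] Kx'; exists i => y Ky hy; apply: eU => //.
    rewrite -(subrKA (h x')) (le_lt_trans (ler_normD _ _))// (splitr e) ltrD//.
    exact: lt_trans hy hd.
  move=> Kd; near (0:R)^'+ => d; exists d => //; exact: (near Kd).
(* With this scale the side [s (n + 1)] of a cell is exactly [d]. *)
pose s : R := d / n.+1%:R.
have s0 : 0 < s by exact: divr_gt0.
(* Every cell meeting the image of [K] is assigned one index [i] such that [U i] contains the part
   of [K] over that cell. *)
have /choice[g gP] (ja : 'I_n.+1 * ('I_n -> int)) : exists o : option I,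
    forall y, K y -> cube s ja.1 ja.2 (h y) -> exists2 i, o = Some i & U i y.
  have [[x [Kx jax]]|nx] := pselect (exists x, K x /\ cube s ja.1 ja.2 (h x)).
    have [i iP] := dP x Kx; exists (Some i) => y Ky jay; exists i => //.
    apply: iP => //; apply: lt_le_trans (cube_dist s0 jax jay) _.
    by rewrite /s divfK.
  by exists None => y Ky jay; case: nx; exists y.
(* Off [K] nothing is removed from [U i]; on [K] only the points in cells assigned to [i] remain.
   The cell condition is not restricted to [K], so that it is open around points of [K]. *)
pose V i := U i `&` (~` K `|` [set x | exists2 ja,
  g ja = Some i & cube s ja.1 ja.2 (h x)]).
exists V; split.
- move=> i; rewrite openE => x [Uix Vx]; rewrite /interior.
  apply: filterI; first exact: open_nbhs_nbhs.
  have [Kx|nKx] := pselect (K x); last first.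
    have : nbhs x (~` K) by apply: open_nbhs_nbhs; split=> //; exact: closed_openC.
    by apply: filterS => y; left.
  case: Vx => // -[ja gja jax].
  have : \forall y \near x, cube s ja.1 ja.2 (h y).
    apply: (ch x) => //; apply: open_nbhs_nbhs; split=> //; exact: open_cube.
  by apply: filterS => y jay; right; exists ja.
- move=> x; have [Kx|nKx] := pselect (K x); last first.
    by have [i Uix] := cU x; exists i; split=> //; left.
  have [j [a jax]] := cube_cover (h x) s0.
  have [i gi Uix] := gP (j, a) x Kx jax.
  by exists i; split=> //; right; exists (j, a).
- by move=> i x [].
- move=> x Kx.
  (* [h x] lies in at most one cell of each colour, so the indices at [x] are among [n + 1] values
     of [g]. *)
  have /choice[a aP] (j : 'I_n.+1) : exists a : 'I_n -> int,
      forall b, cube s j b (h x) -> b = a.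
    have [[a ax]|na] := pselect (exists a, cube s j a (h x)).
      by exists a => b bx; exact: cube_inj bx ax.
    by exists (fun=> 0) => b bx; case: na; exists b.
  rewrite -card_ge_some.
  apply: card_le_trans (card_image_le (fun j => g (inord j, a (inord j))) _).
  apply: subset_card_le => _ [i [_ [//|[[j b] gi bx]]] <-].
  by exists j => /=; [exact: ltn_ord|rewrite inord_val -(aP j b bx)].
Unshelve. all: by end_near. Qed.

(** Each point has a compact neighbourhood inside one chart, the image of a closed ball under the
    inverse chart; there the chart serves as the coordinate map. *)
Lemma dim_le_in_manifold (R : realType) (T : topologicalType) n
    (sT : manifold R T n) (K : set T) :
  compact K -> dim_le_in K n.
Proof.
move=> cK; apply: dim_le_in_compact cK _ => p _.
have hT := manifold_hausdorff sT.
pose c := chart_at sT p; pose h := chart_map c.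
pose hinv := chart_inv c.
have cp : chart_dom c p by exact: dom_chart_at.
have [r r0 rP] : exists2 r : R, 0 < r &
    [set y | `|h p - y| <= r] `<=` chart_im c.
  have : nbhs (h p) (chart_im c).
    by apply: open_nbhs_nbhs; split; [exact: chart_im_open|exists p].
  move=> /nbhs_ballP[e /= e0 eP]; exists (e / 2); first exact: divr_gt0.
  move=> y /= yr; apply: eP; rewrite -ball_normE /=; apply: le_lt_trans yr _.
  by rewrite ltr_pdivrMr// ltr_pMr// ltr1n.
pose B := [set y | `|h p - y| <= r].
have cB : compact B.
  apply: bounded_closed_compact.
    exists (`|h p| + r); split; first exact: num_real.
    move=> M rM y /= yr; apply: le_trans (ltW rM).
    by rewrite -[y](subKr (h p)) (le_trans (ler_normB _ _))// lerD2l.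
  exact: closed_closed_ball_.
have cL : compact (hinv @` B).
  apply: continuous_compact cB; rewrite continuous_subspace_in => y.
  rewrite inE => By; apply: continuous_subspaceT_for => //.
  exact/chart_inv_continuous/rP.
have domL x : (hinv @` B) x -> chart_dom c x /\ B (h x).
  move=> [y By <-]; have [q qc e] := rP _ By.
  by rewrite -e /hinv chart_mapK// /h e.
exists (hinv @` B).
  have : \forall x \near p, chart_dom c x /\ `|h p - h x| < r.
    apply: filterI; first by apply: open_nbhs_nbhs; split; [exact: chart_dom_open|].
    have /cvgrPdist_lt := chart_map_continuous cp; exact.
  apply: filterS => x [xc xr]; exists (h x); first exact: ltW.
  exact: chart_mapK.
apply: (dim_le_in_coord (h := h)) => //.
- exact: compact_closed.
- by move=> x /domL[xc _]; exact: chart_map_continuous.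
- move=> x W /domL[xc Bx] xW.
  have : nbhs (h x) (hinv @^-1` W).
    by apply: (chart_inv_continuous (c := c) (x := h x)); [exact: rP|rewrite chart_mapK].
  move=> /nbhs_ballP[e /= e0 eP]; near=> e' => y /domL[yc By] hxy.
  rewrite -[y](chart_mapK (c := c))//; apply: eP; rewrite -ball_normE /=.
  by apply: lt_trans hxy _; near: e'; exact: nbhs_right_lt.
Unshelve. all: by end_near. Qed.

(** * Mean value estimates and the chain rule *)

Section Calculus.
Context {R : realType}.

(** For the maximum norm, the scalar mean value theorem applies to each coordinate with its own
    intermediate point. *)
Lemma mvt_norm_le n (y dy : R -> 'rV[R]_n) (a b M : R) :
  a <= b -> 0 <= M ->
  (forall t, t \in `[a, b] -> {for t, continuous y}) ->
  (forall t, t \in `]a, b[ -> is_derive t 1 y (dy t) /\ `|dy t| <= M) ->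
  `|y b - y a| <= M * (b - a).
Proof.
move=> ab M0 cy hy; rewrite [leLHS]/Num.norm/= mx_normrE.
apply: bigmax_le => [|[i0 i] _ /=]; first by rewrite mulr_ge0// subr_ge0.
rewrite ord1 !mxE.
have dyi (t : R) : t \in `]a, b[ -> is_derive t 1 (fun t => y t ord0 i) (dy t ord0 i).
  move=> /hy[[dyt <-] _]; split; first exact: (iffLR (derivable_mxP y t 1) dyt).
  by rewrite derive_mx// mxE.
have [altb|] := ltP a b; last first.
  by move=> ba; have -> : a = b by [apply/eqP; rewrite eq_le ab]; rewrite !subrr normr0 mulr0.
have [|c cab ->] := MVT altb dyi.
  rewrite continuous_subspace_in => t; rewrite inE => tab.
  apply: continuous_subspaceT_for => //.
  apply: (@continuous_comp _ _ _ y (fun M : 'rV[R]_n => M ord0 i)); first exact: cy.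
  exact: (@coord_continuous R 1 n ord0 i).
rewrite normrM (ger0_norm (x := b - a)) ?subr_ge0// ler_wpM2r ?subr_ge0//.
have [_ dyM] := hy c cab; apply: le_trans dyM.
by rewrite [leRHS]/Num.norm/= mx_normrE; apply: (le_bigmax _ _ (ord0, i)).
Qed.

Lemma is_derive_line n p (f : 'rV[R]_n -> 'rV[R]_p) x v (s : R) :
  differentiable f (x + s *: v) ->
  is_derive s 1 (fun s : R => f (x + s *: v)) ('D_v f (x + s *: v)).
Proof.
move=> df; have e : (fun h : R => h^-1 *: (((fun s : R => f (x + s *: v)) \o shift s) (h *: 1)
      - f (x + s *: v))) =
    (fun h => h^-1 *: ((f \o shift (x + s *: v)) (h *: v) - f (x + s *: v))).
  apply/funext => h /=; congr (_ *: (f _ - _)).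
  by rewrite [_ *: 1]mulr1 scalerDl addrCA.
split; last by rewrite /derive e.
rewrite /derivable e; exact: diff_derivable.
Qed.

Lemma norm_derive_le n p (f : 'rV[R]_n -> 'rV[R]_p) x v (C : R) :
  differentiable f x -> (forall i, `|'D_(delta_mx 0 i) f x| <= C) ->
  `|'D_v f x| <= C * n%:R * `|v|.
Proof.
move=> df hC; rewrite deriveE// {1}(row_sum_delta v) linear_sum/=.
apply: le_trans (ler_norm_sum _ _ _) _.
have -> : C * n%:R * `|v| = \sum_(i < n) (C * `|v|).
  by rewrite sumr_const card_ord -[RHS]mulr_natr mulrAC.
apply: ler_sum => i _; rewrite linearZ/= normrZ mulrC -deriveE//.
apply: ler_pM => //.
by rewrite [leRHS]/Num.norm/= mx_normrE; apply: (le_bigmax _ _ (ord0, i)).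
Qed.

(** Continuous partial derivatives are bounded near [x0], and balls are convex, so the mean value
    inequality applies along the segment from [y] to [x]. *)
Lemma C1_locally_lipschitz n p (D : set 'rV[R]_n) (f : 'rV[R]_n -> 'rV[R]_p) x0 :
  open D -> D x0 -> Cr_on 1 D f ->
  exists L e, [/\ 0 <= L, 0 < e & forall x y, ball x0 e x -> ball x0 e y ->
    `|f x - f y| <= L * `|x - y|].
Proof.
move=> oD Dx0 [df cdf].
have : \forall x \near x0, D x /\ forall i, `|'D_(delta_mx 0 i) f x| <=
    (\sum_i `|'D_(delta_mx 0 i) f x0|) + 1.
  apply: filterI; first exact: open_nbhs_nbhs.
  have xF : Filter (nbhs x0) by exact: nbhs_filter.
  apply: (@filter_forall 'rV[R]_n 'I_n _ (nbhs x0) xF) => i.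
  have /cvgrPdist_le/(_ 1 ltr01) := cdf i x0 Dx0.
  apply: filterS => x hx.
  rewrite -['D__ f x](subKr ('D_(delta_mx 0 i) f x0)).
  rewrite (le_trans (ler_normB _ _))// lerD//.
  by rewrite (bigD1 i)//= lerDl sumr_ge0.
set C := _ + 1 => /nbhs_ballP[e /= e0 eP].
have C0 : 0 <= C by rewrite /C addr_ge0// sumr_ge0.
exists (C * n%:R), e; split=> //; first by rewrite mulr_ge0.
move=> x y bx by_.
have seg (s : R) : s \in `[0, 1] -> ball x0 e (y + s *: (x - y)).
  rewrite in_itv/= -ball_normE/= => /andP[s0 s1].
  move: bx by_; rewrite -!ball_normE/= => bx by_.
  have -> : x0 - (y + s *: (x - y)) = s *: (x0 - x) + (1 - s) *: (x0 - y).
    apply/rowP => i; rewrite !mxE; ring.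
  apply: le_lt_trans (ler_normD _ _) _; rewrite !normrZ.
  rewrite ger0_norm// (ger0_norm (x := 1 - s)) ?subr_ge0//.
  have [->|sn0] := eqVneq s 0; first by rewrite mul0r subr0 mul1r add0r.
  have -> : e = s * e + (1 - s) * e by ring.
  apply: ltr_leD; last by rewrite ler_wpM2l ?subr_ge0// ltW.
  by rewrite ltr_pM2l// lt_neqAle eq_sym sn0.
have dline (s : R) : s \in `[0, 1] ->
    is_derive s 1 (fun s : R => f (y + s *: (x - y))) ('D_(x - y) f (y + s *: (x - y))).
  by move=> s01; apply: is_derive_line; apply: df; have [] := eP _ (seg s s01).
have := @mvt_norm_le p (fun s => f (y + s *: (x - y)))
  (fun s => 'D_(x - y) f (y + s *: (x - y))) 0 1 (C * n%:R * `|x - y|) ler01.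
rewrite scale1r scale0r addr0 subrKC subr0 mulr1; apply.
- by rewrite !mulr_ge0.
- move=> s /dline[+ _] => /derivable1_diffP; exact: differentiable_continuous.
- move=> s s01; have {}s01 : s \in `[0, 1] by exact: subset_itv_oo_cc s01.
  split; first exact: dline.
  have [Ds hC] := eP _ (seg s s01); apply: norm_derive_le hC; exact: df.
Qed.

Lemma is_derive_comp_mx n p (y : R -> 'rV[R]_n) (f : 'rV[R]_n -> 'rV[R]_p) (t : R) v :
  is_derive t 1 y v -> differentiable f (y t) ->
  is_derive t 1 (f \o y) (v *m 'J f (y t)).
Proof.
move=> [/derivable1_diffP dy yv] df; split.
  by apply/derivable1_diffP; exact: differentiable_comp.
rewrite deriveE; last exact: differentiable_comp.
by rewrite diff_comp//= -(deriveE _ dy) yv -deriveE// deriveEjacobian.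
Qed.

Lemma is_derive_near {W : normedModType R} {y z : R -> W} {t : R} {v} :
  (\forall s \near t, y s = z s) -> is_derive t 1 y v -> is_derive t 1 z v.
Proof.
move=> yz [dy <-]; split; first exact: near_eq_derivable dy.
by apply/esym; exact: near_eq_derive.
Qed.

End Calculus.

(** * Flow lines on manifolds and their uniqueness *)

(* The value at 0 is constrained by continuity only, which suffices for
   uniqueness; a semiflow orbit is extended to t < 0 by its initial point. *)
Definition flow_line (R : realType) (T : topologicalType) (n : nat)
    (sT : manifold R T n) (X : T -> 'rV[R]_n) (c : R -> T) : Prop :=
  continuous c /\ forall t : R, 0 < t ->
    is_derive t 1 (chart_map (chart_at sT (c t)) \o c) (X (c t)).

(** The chart in [flow_line] moves with [t], while comparing two curves takes one fixed chart. The
    transition map carries the velocity over. *)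
Lemma flow_line_chart (R : realType) (T : topologicalType) (n : nat)
    (sT : manifold R T n) (X : T -> 'rV[R]_n) (c : R -> T) k (t : R) :
  flow_line sT X c -> atlas sT k -> 0 < t -> chart_dom k (c t) ->
  is_derive t 1 (chart_map k \o c) (vf_coord sT k X (chart_map k (c t))).
Proof.
move=> [cc dc] ak t0 kt; set l := chart_at sT (c t).
have lt : chart_dom l (c t) by exact: dom_chart_at.
rewrite /vf_coord chart_mapK// -/l.
apply: (is_derive_near (y := (chart_map k \o chart_inv l) \o (chart_map l \o c))).
  have : \forall s \near t, chart_dom l (c s).
    by apply: cc; apply: open_nbhs_nbhs; split=> //; exact: chart_dom_open.
  by apply: filterS => s ls /=; rewrite chart_mapK.
apply: is_derive_comp_mx; first exact: dc.
have [+ _] := atlas_compat (chart_at_atlas sT (c t)) ak 1%N.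
by apply; exists (c t).
Qed.

Lemma flow_line_push (R : realType) (S T : topologicalType) (n p : nat)
    (sS : manifold R S n) (sT : manifold R T p) (f : S -> T)
    (X : S -> 'rV[R]_n) (Y : T -> 'rV[R]_p) (c : R -> S) :
  smooth_map sS sT f -> (forall x, X x *m mdiff sS sT f x = Y (f x)) ->
  flow_line sS X c -> flow_line sT Y (f \o c).
Proof.
move=> [cf sf] XY [cc dc]; split=> [t|t t0].
  by apply: continuous_comp; [exact: cc|exact: cf].
set l := chart_at sS (c t); rewrite -XY /=; set k := chart_at sT (f (c t)).
have lt : chart_dom l (c t) by exact: dom_chart_at.
apply: (is_derive_near (y := (chart_map k \o f \o chart_inv l) \o (chart_map l \o c))).
  have : \forall s \near t, chart_dom l (c s).
    by apply: cc; apply: open_nbhs_nbhs; split=> //; exact: chart_dom_open.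
  by apply: filterS => s ls /=; rewrite chart_mapK.
apply: is_derive_comp_mx; first exact: dc.
have [+ _] := sf _ _ (chart_at_atlas sS (c t)) (chart_at_atlas sT (f (c t))) 1%N.
by apply; exists (c t) => //; split=> //; exact: dom_chart_at.
Qed.

Lemma flow_line_integral_curve (R : realType) (T : topologicalType) (n : nat)
    (sT : manifold R T n) (X : T -> 'rV[R]_n) (phi : R -> T -> T) x :
  generates sT X phi -> flow_line sT X (fun t => phi (Num.max 0 t) x).
Proof.
move=> [[/subspace_continuousP cphi _ _] iphi]; split=> [t|t t0].
  have cm : (fun s : R => Num.max 0 s) @ t --> Num.max 0 t.
    by apply: continuous_max; [exact: cvg_cst|exact: cvg_id].
  have cx : (fun s : R => (Num.max 0 s, x)) @ t --> nbhs (Num.max 0 t, x).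
    have /= := cvg_pair cm (cvg_cst (F := nbhs t) x); exact.
  have m0 (s : R) : 0 <= Num.max 0 s by rewrite le_max lexx.
  move=> W Wt; have /cx tW := cphi (Num.max 0 t, x) (m0 t) W Wt.
  by apply: (@filterS _ (nbhs t) _ _ _ _ tW) => s /=; apply; exact: m0.
have tE : Num.max 0 t = t by apply/max_idPr/ltW.
rewrite tE; set l := chart_at sT (phi t x).
apply: (is_derive_near (y := fun s => chart_map l (phi s x))).
  have : \forall s \near t, 0 < s by exact: lt_nbhsr.
  by apply: filterS => s s0 /=; rewrite (max_idPr (ltW s0)).
(* For [t > 0] the restriction [0 <= t + h] holds for all small [h], so the limit in
   [integral_curve] is an ordinary derivative. *)
have dl : (fun h : R => h^-1 *: (((fun s => chart_map l (phi s x)) \o shift t) (h *: 1)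
    - chart_map l (phi t x))) @ 0^' --> X (phi t x).
  have {}iphi := iphi x t (ltW t0).
  move=> W Wx; have hW : \forall h \near (0:R)^', 0 <= t + h ->
    W (h^-1 *: (chart_map l (phi (t + h) x) - chart_map l (phi t x))) by exact: iphi.
  have ht : \forall h \near (0:R)^', 0 <= t + h.
    apply: nbhs_dnbhs; have : nbhs (0:R) [set h | - t < h].
      by apply: lt_nbhsr; rewrite oppr_lt0.
    by apply: filterS => h /=; rewrite -subr_gt0 opprK addrC => /ltW.
  apply: (@filterS _ (0:R)^' _ _ _ _ (filterI hW ht)) => h [/[apply]] /=.
  by rewrite [_ *: 1]mulr1 (addrC h).
by split; [apply/cvg_ex; exists (X (phi t x))|exact: cvg_lim].
Qed.

Lemma flow_line_eq_right (R : realType) (T : topologicalType) (n : nat)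
    (sT : manifold R T n) (X : T -> 'rV[R]_n) (c1 c2 : R -> T) (tau : R) :
  Cr_vfield sT 1 X -> flow_line sT X c1 -> flow_line sT X c2 ->
  0 <= tau -> c1 tau = c2 tau ->
  exists2 e, 0 < e & forall s, tau <= s <= tau + e -> c1 s = c2 s.
Proof.
move=> CX f1 f2 tau0 c12; set k := chart_at sT (c1 tau).
have kc1 : chart_dom k (c1 tau) by exact: dom_chart_at.
have imc1 : chart_im k (chart_map k (c1 tau)) by exists (c1 tau).
have ak : atlas sT k by exact: chart_at_atlas.
have [L [r [L0 r0 lip]]] :=
  C1_locally_lipschitz (@chart_im_open R T n k) imc1 (CX k ak).
have close (c : R -> T) : continuous c -> c tau = c1 tau -> \forall s \near tau,
    chart_dom k (c s) /\ ball (chart_map k (c1 tau)) r (chart_map k (c s)).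
  move=> cc ctau.
  have /cc : nbhs (c tau)
      [set p | chart_dom k p /\ ball (chart_map k (c1 tau)) r (chart_map k p)].
    rewrite ctau; apply: filterI.
      by apply: open_nbhs_nbhs; split=> //; exact: chart_dom_open.
    by apply: (chart_map_continuous kc1); exact: nbhsx_ballx.
  by move=> nb; apply: (@filterS _ (nbhs tau) _ _ _ _ nb) => s [].
have /nbhs_ballP[d /= d0 hd] : \forall s \near tau,
    (chart_dom k (c1 s) /\ ball (chart_map k (c1 tau)) r (chart_map k (c1 s))) /\
    (chart_dom k (c2 s) /\ ball (chart_map k (c1 tau)) r (chart_map k (c2 s))).
  exact: filterI (close c1 (proj1 f1) erefl) (close c2 (proj1 f2) (esym c12)).
(* e is small enough that the mean value inequality on [tau, tau + e] bounds the
   maximum of the difference z of the two curves by half of itself *)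
pose e := Num.min (d / 2) (2 * (L + 1))^-1.
have e0 : 0 < e by rewrite lt_min divr_gt0//= invr_gt0 mulr_gt0// ltr_wpDl.
have ed : e < d.
  apply: (@le_lt_trans _ _ (d / 2)); first by rewrite ge_min lexx.
  by rewrite ltr_pdivrMr// ltr_pMr// ltr1n.
have hs s : tau <= s <= tau + e -> [/\ chart_dom k (c1 s), chart_dom k (c2 s),
    ball (chart_map k (c1 tau)) r (chart_map k (c1 s)) &
    ball (chart_map k (c1 tau)) r (chart_map k (c2 s))].
  move=> /andP[s1 s2]; have [|[? ?] [? ?]] := hd s; last by split.
  rewrite -ball_normE/= distrC ger0_norm ?subr_ge0// ltrBlDl.
  by apply: le_lt_trans s2 _; rewrite ltrD2l.
pose z := (chart_map k \o c1) - (chart_map k \o c2).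
have zE s : z s = chart_map k (c1 s) - chart_map k (c2 s) by [].
have cz s : tau <= s <= tau + e -> {for s, continuous z}.
  move=> /hs[k1 k2 _ _]; apply: cvgB.
    by apply: continuous_comp; [exact: (proj1 f1)|exact: chart_map_continuous].
  by apply: continuous_comp; [exact: (proj1 f2)|exact: chart_map_continuous].
have [sm smI maxz] : exists2 sm, sm \in `[tau, tau + e] &
    forall s, s \in `[tau, tau + e] -> `|z s| <= `|z sm|.
  apply: EVT_max; first by rewrite lerDl ltW.
  rewrite continuous_subspace_in => s; rewrite inE/= in_itv/= => sI.
  apply: continuous_subspaceT_for; first by rewrite /= in_itv.
  by apply: cvg_norm; exact: cz.
rewrite in_itv/= in smI; case/andP: (smI) => sm1 sm2.
have zle : `|z sm - z tau| <= (L * `|z sm|) * (sm - tau).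
  pose dz t := vf_coord sT k X (chart_map k (c1 t)) -
    vf_coord sT k X (chart_map k (c2 t)).
  apply: (mvt_norm_le (dy := dz) sm1).
  - by rewrite mulr_ge0.
  - move=> t; rewrite in_itv/= => /andP[t1 t2]; apply: cz.
    by rewrite t1 (le_trans t2).
  - move=> t; rewrite in_itv/= => /andP[t1 t2].
    have t0 : 0 < t by exact: le_lt_trans t1.
    have tI : tau <= t <= tau + e by rewrite ltW//= (le_trans (ltW t2)).
    have [k1 k2 b1 b2] := hs t tI; split.
      by apply: is_deriveB; exact: flow_line_chart.
    apply: le_trans (lip _ _ b1 b2) _; apply: ler_wpM2l => //.
    by rewrite -zE; apply: maxz; rewrite in_itv.
have ztau : z tau = 0 by rewrite zE c12 subrr.
rewrite ztau subr0 in zle.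
have zm0 : `|z sm| = 0.
  apply/eqP; rewrite eq_le normr_ge0 andbT.
  (* The [L + 1] in [e] keeps the denominator positive when [L = 0] and still bounds [L * e] by one
     half. *)
  have Le : L * (sm - tau) <= 1 / 2.
    have : sm - tau <= (2 * (L + 1))^-1.
      by rewrite lerBlDl (le_trans sm2)// lerD2l ge_min lexx orbT.
    move=> /(ler_wpM2l L0) /le_trans; apply.
    by rewrite ler_pdivrMr ?mulr_gt0 ?ltr_wpDl//; lra.
  have : L * `|z sm| * (sm - tau) <= 1 / 2 * `|z sm|.
    by rewrite mulrAC ler_wpM2r.
  move: zle; lra.
exists e => // s sI; have [k1 k2 _ _] := hs s sI.
rewrite -(chart_mapK k1) -(chart_mapK k2); congr (chart_inv k _).
apply/eqP; rewrite -subr_eq0 -zE -normr_le0 -zm0; apply: maxz.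
by rewrite in_itv.
Qed.

Lemma hausdorff_neq_near (S T : topologicalType) (f g : S -> T) x :
  hausdorff_space T -> continuous f -> continuous g -> f x != g x ->
  \forall y \near x, f y != g y.
Proof.
rewrite open_hausdorff => hT cf cg /hT[[A B]] /= [fA gB] [oA oB AB].
rewrite !inE in fA gB.
have fx : \forall y \near x, A (f y) by apply: cf; exact: open_nbhs_nbhs.
have gx : \forall y \near x, B (g y) by apply: cg; exact: open_nbhs_nbhs.
apply: filterS2 fx gx => y Ay By; apply/eqP => e; move/eqP: AB; apply/eqP/set0P.
by exists (f y); split=> //; rewrite e.
Qed.

(** Continuation: agreement passes to the supremum [tau] of the times up to which the curves agree,
    since [T] is Hausdorff, and local uniqueness to the right would then carry it beyond [tau]. *)
Lemma flow_line_unique (R : realType) (T : topologicalType) (n : nat)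
    (sT : manifold R T n) (X : T -> 'rV[R]_n) (c1 c2 : R -> T) :
  Cr_vfield sT 1 X -> flow_line sT X c1 -> flow_line sT X c2 ->
  c1 0 = c2 0 -> forall t, 0 <= t -> c1 t = c2 t.
Proof.
move=> CX f1 f2 c12 t t0; apply: contrapT => /eqP ct.
pose E := [set s | 0 <= s /\ forall u, 0 <= u <= s -> c1 u = c2 u].
have E0 : E 0 by split=> // u; rewrite -eq_le => /eqP <-.
have Et s : E s -> s <= t.
  move=> [s0 Es]; rewrite leNgt; apply/negP => ts.
  by move: ct; rewrite Es ?eqxx// t0 ltW.
have supE : has_sup E by split; [exists 0|exists t].
set tau := sup E.
have tau0 : 0 <= tau by exact: (ub_le_sup (proj2 supE)).
have below u : 0 <= u -> u < tau -> c1 u = c2 u.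
  move=> u0 ut; have := sup_adherent (eps := tau - u).
  rewrite subr_gt0 => /(_ _ ut supE)[s [_ Es]].
  by rewrite subKr => us; apply: Es; rewrite u0 ltW.
have etau : c1 tau = c2 tau.
  have [->//|tau_gt0] := eqVneq tau 0; apply: contrapT => /eqP.
  move=> /(hausdorff_neq_near (manifold_hausdorff sT) (proj1 f1) (proj1 f2)).
  move=> /nbhs_ballP[d /= d0 hd].
  (* A nonnegative time before [tau] and within [d] of it, where the curves both agree and
     differ. *)
  pose u := Num.max (tau - d / 2) 0.
  have ut : u < tau.
    by rewrite gt_max ltrBlDr ltrDl divr_gt0//= lt_neqAle eq_sym tau_gt0.
  have u0 : 0 <= u by rewrite le_max lexx orbT.
  have := hd u; rewrite -ball_normE/= below// eqxx => contra; apply/notF/contra.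
  rewrite ger0_norm ?subr_ge0 1?ltW// ltrBlDl -ltrBlDr.
  by rewrite lt_max ltrD2l ltrN2 ltr_pdivrMr// ltr_pMr// ltr1n.
have [e e0 he] := flow_line_eq_right CX f1 f2 tau0 etau.
have : E (tau + e).
  split=> [|u /andP[u0 ue]]; first by rewrite addr_ge0// ltW.
  have [ut|tu] := ltP u tau; first exact: below.
  by apply: he; rewrite tu.
by move=> /(ub_le_sup (proj2 supE)); rewrite -/tau gerDl leNgt e0.
Qed.

(** * Semiconjugate semiflows and the reduced attractor *)

Lemma Cr_vfieldS (R : realType) (T : topologicalType) (n r : nat)
    (sT : manifold R T n) (X : T -> 'rV[R]_n) :
  Cr_vfield sT r.+1 X -> Cr_vfield sT r X.
Proof.
have Cr_onS (D : set 'rV[R]_n) (f : 'rV[R]_n -> 'rV[R]_n) :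
    Cr_on r.+1 D f -> Cr_on r D f.
  elim: r f => [|r IH] f [df Df] /=.
    by move=> x /df; exact: differentiable_continuous.
  by split=> // i; exact: IH.
by move=> CX c ac; apply: Cr_onS; exact: CX.
Qed.

(** As functions of [t], both sides are flow lines of [Y] starting at [f x]. *)
Lemma generates_semiconj (R : realType) (S T : topologicalType) (n p : nat)
    (sS : manifold R S n) (sT : manifold R T p) (f : S -> T)
    (X : S -> 'rV[R]_n) (Y : T -> 'rV[R]_p)
    (phi : R -> S -> S) (psi : R -> T -> T) (t : R) (x : S) :
  smooth_map sS sT f -> (forall x, X x *m mdiff sS sT f x = Y (f x)) ->
  Cr_vfield sT 1 Y -> generates sS X phi -> generates sT Y psi ->
  0 <= t -> f (phi t x) = psi t (f x).
Proof.
move=> sf XY CY gphi gpsi t0.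
have fphi := flow_line_push sf XY (flow_line_integral_curve x gphi).
have fpsi := flow_line_integral_curve (f x) gpsi.
have [[_ phi0 _] _] := gphi; have [[_ psi0 _] _] := gpsi.
have := flow_line_unique CY fphi fpsi.
rewrite /= !maxxx phi0 psi0 => /(_ erefl t t0); rewrite (max_idPr t0); exact.
Qed.

Lemma invariant_under_image (R : realType) (S T : topologicalType) (f : S -> T)
    (phi : R -> S -> S) (psi : R -> T -> T) (A : set S) :
  (forall t x, 0 <= t -> f (phi t x) = psi t (f x)) ->
  invariant_under phi A -> invariant_under psi (f @` A).
Proof.
move=> fphi invA t t0; apply/seteqP; split=> [_ [_ [x Ax <-] <-]|_ [x Ax <-]].
  by exists (phi t x); [rewrite -(invA t t0); exists x|rewrite fphi].
have [y Ay <-] : (phi t @` A) x by rewrite invA.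
by exists (f y); [exists y|rewrite fphi].
Qed.

Unset Implicit Arguments.
Set Strict Implicit.

Theorem theorem6p2 (R : realType) (m k : nat)
  (* the ambient Lorentzian manifold and the constraint hypersurface M *)
  (U : topologicalType) (sU : manifold R U m.+1)
  (g : U -> 'M[R]_m.+1)
  (g_smooth : smooth_form sU g)
  (g_lorentz : forall p, lorentzian (g p))
  (Phi : U -> R)
  (Phi_smooth : smooth_fun sU Phi)
  (Phi_regular : forall p, Phi p = 0 -> dfun sU Phi p != 0)
  (sM : manifold R (hypersurface Phi) m)
  (sM_submanifold : immersion sM sU (hyp_incl (Phi := Phi)))
  (* the null distribution *)
  (k_gt0 : (0 < k)%N)
  (corank_k : forall p, (\rank (induced_form sU sM g p) + k)%N = m)
  (* the constraint-preserving vector field *)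
  (V : U -> 'rV[R]_m.+1)
  (V_C2 : Cr_vfield sU 2 V)
  (V_tangent : forall p, Phi p = 0 -> V p *m dfun sU Phi p = 0)
  (* hypothesis (1) *)
  (d : hypersurface Phi -> hypersurface Phi -> R)
  (d_dist : distance_inducing_topology d)
  (phi : R -> hypersurface Phi -> hypersurface Phi)
  (phi_flow : generates sM (intrinsic_vfield sU sM V) phi)
  (phi_ac : asymptotically_compact d phi)
  (phi_absorbing : exists B, bounded_absorbing d phi B)
  (* hypothesis (2) *)
  (N_involutive : involutive_distribution sM (null_distribution sU sM g))
  (leaves_compact : forall S, leaf sM (null_distribution sU sM g) k S ->
     compact_embedded_leaf sM (null_distribution sU sM g) k S)
  (Mred_hausdorff :
    hausdorff_space (reduced_space k sU sM g))
  (* the smooth structure of the leaf space *)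
  (sMred : manifold R (reduced_space k sU sM g) (m - k))
  (pi_submersion :
     submersion sM sMred (reduction k sU sM g))
  (* hypothesis (3) *)
  (V_projectable :
     projectable sM (null_distribution sU sM g) (intrinsic_vfield sU sM V))
  (* the reduced vector field and its semiflow *)
  (Vred : reduced_space k sU sM g -> 'rV[R]_(m - k))
  (Vred_C2 : Cr_vfield sMred 2 Vred)
  (Vred_pi : forall X,
     intrinsic_vfield sU sM V X
       *m mdiff sM sMred (reduction k sU sM g) X
     = Vred (reduction k sU sM g X))
  (psi : R -> reduced_space k sU sM g ->
         reduced_space k sU sM g)
  (psi_flow : generates sMred Vred psi)
  (* the global attractor *)
  (A : set (hypersurface Phi))
  (A_attractor : global_attractor d phi A) :
  let Ared := reduction k sU sM g @` A in
  [/\ compact Ared,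
      invariant_under psi Ared &
      covering_dim_le (set_type Ared) (m - k)].
Proof.
move=> Ared; have [cA invA _] := A_attractor.
have [pi_smooth _] := pi_submersion.
have cAred : compact Ared.
  by apply: continuous_compact cA; apply: continuous_subspaceT; case: pi_smooth.
split; first exact: cAred.
  apply: invariant_under_image invA => t x t0.
  exact: generates_semiconj pi_smooth Vred_pi (Cr_vfieldS Vred_C2)
    phi_flow psi_flow t0.
(* The compact image is closed because the leaf space is Hausdorff. *)
exact: covering_dim_le_closed (compact_closed Mred_hausdorff cAred)
  (dim_le_in_manifold sMred cAred).
Qed.
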